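(* Let $(R,\mathfrak{m})$ be a commutative noetherian local ring and $M$ a separated $R$-module such that $M/\mathfrak{m}M$ is finitely generated. If $M$ is pure in its $\mathfrak{m}$-adic completion $\hat M$, then $M$ is totally separated.
   Context: An $R$-module $A$ is separated if $\bigcap_{n\ge1}\mathfrak{m}^nA=0$; a separated module $M$ is regarded as a submodule of $\hat M=\varprojlim M/\mathfrak{m}^nM$ via the canonical map. $M$ is totally separated if $X\otimes_RM$ is separated for every finitely generated $R$-module $X$. *)

(* Defs.v *)
From HB Require Import structures.
From mathcomp Require Import all_boot all_algebra.
From mathcomp Require Import generic_quotient ring_quotient.
From mathcomp Require Import boolp classical_sets functions.
From mathcomp Require Import sesquilinear.
From mathcomp Require Import freeg.

Set Implicit Arguments.
Unset Strict Implicit.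
Unset Printing Implicit Defensive.

Import GRing.Theory.

Local Open Scope classical_set_scope.
Local Open Scope ring_scope.
Local Open Scope quotient_scope.

(* Submodules are the Boolean predicates closed under the module operations
   ([submodClosed M]); classical logic turns every Prop-valued submodule into
   such a predicate. Ideals of a commutative ring [R] are the submodules of the
   regular module [R^o]; in particular [R] itself is an ideal. *)

Section Span.
Variables (R : comNzRingType) (M : lmodType R).

Definition span (S : set M) : {pred M} :=
  fun x => x \in smallest [set N : set M | submod_closed [in N]] S.

Lemma span_sub (S : set M) x : S x -> x \in span S.
Proof. by move=> Sx; rewrite unfold_in; apply/mem_set => N [_]; apply. Qed.

Lemma span_min (S : set M) (N : submodClosed M) :
  (forall x, S x -> x \in N) -> {subset span S <= N}.
Proof.
move=> SN x; rewrite unfold_in => /set_mem /(_ [set` N]); apply; split=> //=.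
split; first by rewrite inE /=; exact: rpred0.
by move=> a u v; rewrite !inE /= => uN vN; rewrite rpredD ?rpredZ.
Qed.

Fact span_submod_closed (S : set M) : submod_closed (span S).
Proof.
split=> [|a u v]; rewrite !unfold_in.
  by apply/mem_set => N [[N0 _] _]; apply/set_mem.
move=> /set_mem uS /set_mem vS; apply/mem_set => N [Ncl SN].
by apply/set_mem/Ncl.2; apply/mem_set; [exact: uS | exact: vS].
Qed.

HB.instance Definition _ (S : set M) :=
  GRing.isSubmodClosed.Build R M (span S) (span_submod_closed S).

End Span.

Definition fin_gen (R : comNzRingType) (M : lmodType R) : Prop :=
  exists s : seq M, forall x : M, x \in span [set` s].

Definition noetherian (R : comNzRingType) : Prop :=
  forall I : submodClosed R^o, exists s : seq R^o, I =i span [set` s].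

Definition maximal_ideal (R : comNzRingType) (I : submodClosed R^o) : Prop :=
  (1 : R^o) \notin I /\
  forall J : submodClosed R^o,
    {subset I <= J} -> (1 : R^o) \notin J -> J =i I.

Definition local_ring (R : comNzRingType) (m : submodClosed R^o) : Prop :=
  maximal_ideal m /\
  forall I : submodClosed R^o, maximal_ideal I -> I =i m.

Section QuotientModule.
Variables (R : comNzRingType) (M : lmodType R) (N : submodClosed M).

Definition submod_pred : {pred M} := fun x => x \in N.

Fact submod_pred_zmod_closed : zmod_closed submod_pred.
Proof.
split=> [|x y]; first exact: (rpred0 N).
by move=> Nx Ny; rewrite -scaleN1r; apply: (rpredD Nx); apply: rpredZ.
Qed.

HB.instance Definition _ :=
  GRing.isZmodClosed.Build M submod_pred submod_pred_zmod_closed.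

Definition quotmod : Type := Quotient.quot submod_pred.

HB.instance Definition _ := GRing.Zmodule.on quotmod.
HB.instance Definition _ := Quotient.on quotmod.

Definition qpi (x : M) : quotmod := \pi_quotmod x.

Lemma qpi_eq (x y : M) : (qpi x == qpi y) = (x - y \in N).
Proof. by rewrite [RHS](@Quotient.idealrBE M submod_pred). Qed.

Lemma qpiP (q : quotmod) : qpi (repr q) = q.
Proof. exact: reprK. Qed.

Fact qpi_is_zmod_morphism : zmod_morphism qpi.
Proof. by move=> x y; rewrite /qpi !piE. Qed.

Definition qscale (a : R) (q : quotmod) : quotmod := qpi (a *: repr q).

Lemma qscaleE a x : qscale a (qpi x) = qpi (a *: x).
Proof.
apply/eqP; rewrite /qscale qpi_eq -scalerBr rpredZ //.
by rewrite -qpi_eq qpiP.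
Qed.

Fact qscaleA a b q : qscale a (qscale b q) = qscale (a * b) q.
Proof. by rewrite -[q]qpiP !qscaleE scalerA. Qed.

Fact qscale1 : left_id 1 qscale.
Proof. by move=> q; rewrite -[q]qpiP !qscaleE scale1r. Qed.

Let qpiB := qpi_is_zmod_morphism.
Let qpi0 : qpi 0 = 0. Proof. by rewrite -(subrr 0) qpiB subrr. Qed.
Let qpiD x y : qpi (x + y) = qpi x + qpi y.
Proof. by rewrite -{1}[y]opprK qpiB -[- y]sub0r qpiB qpi0 sub0r opprK. Qed.

Fact qscaleDr : right_distributive qscale +%R.
Proof.
move=> a p q; rewrite -[p]qpiP -[q]qpiP.
by rewrite -qpiD !qscaleE scalerDr qpiD.
Qed.

Fact qscaleDl q : {morph qscale^~ q : a b / a + b}.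
Proof. by move=> a b; rewrite -[q]qpiP !qscaleE scalerDl qpiD. Qed.

HB.instance Definition _ := GRing.Zmodule_isLmodule.Build R quotmod
  qscaleA qscale1 qscaleDr qscaleDl.

Fact qpi_is_linear : linear qpi.
Proof. by move=> a x y; rewrite qpiD -qscaleE. Qed.

HB.instance Definition _ :=
  GRing.isLinear.Build R M quotmod _ qpi qpi_is_linear.

End QuotientModule.

Section Adic.
Variable R : comNzRingType.

(* The ideal power I^n, with I^0 = R. *)
Fixpoint idealX (I : {pred R^o}) (n : nat) : {pred R^o} :=
  if n is n'.+1 then
    span [set (a : R^o) * b | a in [set` I] & b in [set` idealX I n']]
  else predT.

(* The submodule I M, generated by the products of elements. *)
Definition ideal_smul (I : {pred R^o}) (M : lmodType R) : {pred M} :=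
  span [set (a : R) *: x | a in [set` I] & x in [set: M]].

HB.instance Definition _ (I : {pred R^o}) (M : lmodType R) :=
  GRing.SubmodClosed.on (@ideal_smul I M).

End Adic.

Arguments ideal_smul {R} I M.

Section Separated.
Variables (R : comNzRingType) (m : {pred R^o}).

Definition adic (M : lmodType R) (n : nat) : {pred M} :=
  ideal_smul (idealX m n) M.

Arguments adic : clear implicits.

HB.instance Definition _ (M : lmodType R) (n : nat) :=
  GRing.SubmodClosed.on (adic M n).

Definition separated (M : lmodType R) : Prop :=
  forall x : M, (forall n, (0 < n)%N -> x \in adic M n) -> x = 0.

End Separated.

Arguments adic {R} m M n.

Section Product.
Variables (R : comNzRingType) (I : Type) (T : I -> lmodType R).

Definition prodmod : Type := forall i, T i.

HB.instance Definition _ := gen_eqMixin prodmod.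
HB.instance Definition _ := gen_choiceMixin prodmod.

Implicit Types x y z : prodmod.

Fact prodmod_addA : associative (fun x y : prodmod => fun i => x i + y i).
Proof. by move=> x y z; apply: functional_extensionality_dep => i; apply: addrA. Qed.
Fact prodmod_addC : commutative (fun x y : prodmod => fun i => x i + y i).
Proof. by move=> x y; apply: functional_extensionality_dep => i; apply: addrC. Qed.
Fact prodmod_add0 :
  left_id (fun i => 0 : T i) (fun x y : prodmod => fun i => x i + y i).
Proof. by move=> x; apply: functional_extensionality_dep => i; apply: add0r. Qed.
Fact prodmod_addN :
  left_inverse (fun i => 0 : T i) (fun x : prodmod => fun i => - x i)
    (fun x y : prodmod => fun i => x i + y i).
Proof. by move=> x; apply: functional_extensionality_dep => i; apply: addNr. Qed.

HB.instance Definition _ := GRing.isZmodule.Build prodmod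
  prodmod_addA prodmod_addC prodmod_add0 prodmod_addN.

Definition prodmod_scale (a : R) (x : prodmod) : prodmod := fun i => a *: x i.

Fact prodmod_scaleA a b x :
  prodmod_scale a (prodmod_scale b x) = prodmod_scale (a * b) x.
Proof. by apply: functional_extensionality_dep => i; apply: scalerA. Qed.
Fact prodmod_scale1 : left_id 1 prodmod_scale.
Proof. by move=> x; apply: functional_extensionality_dep => i; apply: scale1r. Qed.
Fact prodmod_scaleDr : right_distributive prodmod_scale +%R.
Proof. by move=> a x y; apply: functional_extensionality_dep => i; apply: scalerDr. Qed.
Fact prodmod_scaleDl x : {morph prodmod_scale^~ x : a b / a + b}.
Proof. by move=> a b; apply: functional_extensionality_dep => i; apply: scalerDl. Qed.

HB.instance Definition _ := GRing.Zmodule_isLmodule.Build R prodmod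
  prodmod_scaleA prodmod_scale1 prodmod_scaleDr prodmod_scaleDl.

Lemma prodmodP a x y i : (a *: x + y) i = a *: x i + y i.
Proof. by []. Qed.

End Product.

Section Completion.
Variables (R : comNzRingType) (m : {pred R^o}) (M : lmodType R).

Local Notation Mq n := (quotmod (adic m M n)).

(* The projection M / m^j M -> M / m^i M, meaningful for i <= j. *)
Definition adic_proj (i j : nat) (q : Mq j) : Mq i := qpi (adic m M i) (repr q).

Definition coherent : {pred prodmod (fun n => Mq n)} :=
  fun x => `[< forall i j, (i <= j)%N -> adic_proj i (x j) = x i >].

Lemma idealX_anti i j : (i <= j)%N -> {subset idealX m j <= idealX m i}.
Proof.
elim: j i => [|j IHj] [|i] //= lij.
apply: span_min => _ [a am [b bm <-]]; apply: span_sub.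
by exists a => //; exists b => //; apply: IHj.
Qed.

Lemma adic_anti i j : (i <= j)%N -> {subset adic m M j <= adic m M i}.
Proof.
move=> lij; apply: span_min => _ [a am [x xm <-]]; apply: span_sub.
by exists a; [exact: (idealX_anti lij) | exists x].
Qed.

Lemma adic_projE i j x : (i <= j)%N ->
  adic_proj i (qpi (adic m M j) x) = qpi (adic m M i) x.
Proof.
move=> lij; apply/eqP; rewrite /adic_proj qpi_eq; apply: (adic_anti lij).
by rewrite -qpi_eq qpiP.
Qed.

Fact coherent_submod_closed : submod_closed coherent.
Proof.
split=> [|a x y]; rewrite !unfold_in.
  by apply/asboolP => i j lij; rewrite -[X in adic_proj i X](linear0 (qpi _))
     adic_projE // linear0.
move=> /asboolP xC /asboolP yC; apply/asboolP => i j lij.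
rewrite !prodmodP -(xC i j) // -(yC i j) // -[x j in LHS]qpiP -[y j in LHS]qpiP.
by rewrite -linearP adic_projE // linearP.
Qed.

HB.instance Definition _ := GRing.isSubmodClosed.Build R
  (prodmod (fun n => Mq n)) coherent coherent_submod_closed.

(* The inverse limit of the M / m^n M; the component at n = 0 is trivial. *)
Record completion := Completion {
  completion_val :> prodmod (fun n => Mq n);
  _ : completion_val \in coherent
}.

HB.instance Definition _ := [isSub for completion_val].
HB.instance Definition _ := [Choice of completion by <:].
HB.instance Definition _ := [SubChoice_isSubLmodule of completion by <:].

Fact to_completion_subproof (x : M) :
  ((fun n => qpi (adic m M n) x) : prodmod _) \in coherent.
Proof. by apply/asboolP => i j; apply: adic_projE. Qed.

Definition to_completion (x : M) : completion :=
  Completion (to_completion_subproof x).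

Fact to_completion_is_linear : linear to_completion.
Proof.
move=> a x y; apply: val_inj; rewrite linearP /=.
by apply: functional_extensionality_dep => n; rewrite prodmodP /= linearP.
Qed.

HB.instance Definition _ :=
  GRing.isLinear.Build R M completion _ to_completion to_completion_is_linear.

End Completion.

Arguments to_completion {R} m M x.

Section TensorProduct.
Variables (R : comNzRingType) (X M : lmodType R).

Local Notation F := {freeg (X * M) / R}.

Inductive tensor_rel : set F :=
| TensorRelL a x x' y : tensor_rel
    (<< 1 *g (a *: x + x', y) >> - (a *: << 1 *g (x, y) >> + << 1 *g (x', y) >>))
| TensorRelR a x y y' : tensor_rel
    (<< 1 *g (x, a *: y + y') >> - (a *: << 1 *g (x, y) >> + << 1 *g (x, y') >>)).

Definition tensor : Type := quotmod (span tensor_rel).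

HB.instance Definition _ := GRing.Lmodule.on tensor.

Definition tens (x : X) (y : M) : tensor :=
  qpi (span tensor_rel) << 1 *g (x, y) >>.

Fact tens_linearl y : linear (tens^~ y).
Proof.
move=> a x x'; apply/eqP; rewrite -linearP qpi_eq.
by apply: span_sub; apply: TensorRelL.
Qed.

Fact tens_linearr x : linear (tens x).
Proof.
move=> a y y'; apply/eqP; rewrite -linearP qpi_eq.
by apply: span_sub; apply: TensorRelR.
Qed.

End TensorProduct.

Section TensorLift.
Variables (R : comNzRingType) (X M P : lmodType R) (b : X -> M -> P).

(* Linear, and the factorization of [b] through [tens], when [b] is bilinear. *)
Definition tensor_lift (t : tensor X M) : P :=
  fglift (fun p => b p.1 p.2) (repr t).

Hypothesis b_bilinear : bilinear_for *:%R *:%R b.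

Let L : {freeg (X * M) / R} -> P := fglift (fun p => b p.1 p.2).

Let LB : {morph L : x y / x - y}. Proof. exact: lift_is_additive. Qed.
Let L0 : L 0 = 0. Proof. by rewrite -(subrr 0) LB subrr. Qed.
Let LD : {morph L : x y / x + y}.
Proof. by move=> x y; rewrite -[y in LHS]opprK LB -[- y]sub0r LB L0 sub0r opprK. Qed.

Let L_linear : linear L.
Proof.
move=> a u v; rewrite LD; congr (_ + _).
elim/freeg_ind_dom0: u => [|k p D _ _ IHD]; first by rewrite scaler0 L0 scaler0.
rewrite scalerDr !LD scalerDr IHD; congr (_ + _).
have -> : a *: << k *g p >> = << (a * k) *g p >> :> {freeg (X * M) / R}.
  by apply/eqP/freeg_eqP => q; rewrite coeffZ !coeffU mulrA.
by rewrite /L !liftU scalerA.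
Qed.

Let L_rel (u : {freeg (X * M) / R}) : u \in span (@tensor_rel R X M) -> L u = 0.
Proof.
have kerP : submod_closed [pred u | L u == 0].
  split=> [|a v w]; rewrite !inE ?L0 //.
  by move=> /eqP v0 /eqP w0; rewrite L_linear v0 w0 scaler0 addr0.
pose K : submodClosed _ := HB.pack (fun u => L u == 0)
  (GRing.isSubmodClosed.Build R _ (fun u => L u == 0) kerP).
move=> uS; apply/eqP; change (u \in K); apply: span_min uS => _ [] *.
  rewrite unfold_in /= LB L_linear /L !liftU !scale1r /=.
  by rewrite b_bilinear.1 subrr.
rewrite unfold_in /= LB L_linear /L !liftU !scale1r /=.
by rewrite b_bilinear.2 subrr.
Qed.

Lemma tensor_lift_qpi u : tensor_lift (qpi _ u) = L u.
Proof.
apply/eqP; rewrite -subr_eq0 -LB; apply/eqP/L_rel.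
by rewrite -qpi_eq qpiP.
Qed.

Lemma tensor_liftE x y : tensor_lift (tens x y) = b x y.
Proof. by rewrite /tens tensor_lift_qpi /L liftU scale1r. Qed.

Lemma tensor_lift_linear : linear tensor_lift.
Proof.
move=> a s t; rewrite -[s]qpiP -[t]qpiP -linearP !tensor_lift_qpi.
exact: L_linear.
Qed.

End TensorLift.

Lemma tensor_ext (R : comNzRingType) (X M P : lmodType R)
    (f g : {linear tensor X M -> P}) :
  (forall x y, f (tens x y) = g (tens x y)) -> f =1 g.
Proof.
move=> fg t; rewrite -[t]qpiP; elim/freeg_ind_dom0: (repr t).
  by rewrite !linear0.
move=> k [x y] D _ _ IHD; rewrite !linearD IHD; congr (_ + _).
have -> : << k *g (x, y) >> = k *: << 1 *g (x, y) >> :> {freeg (X * M) / R}.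
  by apply/eqP/freeg_eqP => q; rewrite coeffZ !coeffU mul1r.
by rewrite !linearZ /=; congr (_ *: _); apply: fg.
Qed.

(* X ⊗ f *)
Definition tensor_map (R : comNzRingType) (X A B : lmodType R)
    (f : {linear A -> B}) : tensor X A -> tensor X B :=
  tensor_lift (fun x y => tens x (f y)).

Section TensorMap.
Variables (R : comNzRingType) (X A B : lmodType R) (f : {linear A -> B}).

Fact tensor_map_bilinear :
  bilinear_for *:%R *:%R (fun (x : X) (y : A) => tens x (f y)).
Proof.
split=> [y|x] a u v; first exact: tens_linearl.
by rewrite /= linearP tens_linearr.
Qed.

Lemma tensor_mapE x y : tensor_map f (tens x y) = tens x (f y) :> tensor X B.
Proof. exact: (tensor_liftE tensor_map_bilinear). Qed.

HB.instance Definition _ := GRing.isLinear.Build R (tensor X A) (tensor X B) _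
  (tensor_map f) (tensor_lift_linear tensor_map_bilinear).

End TensorMap.

(* An embedding [f] of [A] as a pure submodule of [B]; taking [X := R^o] shows
   that [f] is injective. *)
Definition pure (R : comNzRingType) (A B : lmodType R) (f : {linear A -> B}) :
    Prop :=
  forall X : lmodType R, injective (@tensor_map R X A B f).

Definition totally_separated (R : comNzRingType) (m : {pred R^o})
    (M : lmodType R) : Prop :=
  forall X : lmodType R, fin_gen X -> separated m (tensor X M).

(* Main.v *)
From Pilot Require Import Defs.
From HB Require Import structures.
From mathcomp Require Import all_boot all_algebra.
From mathcomp Require Import boolp classical_sets.
From mathcomp Require Import sesquilinear freeg.
Import Pilot.Defs.

Set Implicit Arguments.
Unset Strict Implicit.
Unset Printing Implicit Defensive.

Import GRing.Theory.

Local Open Scope classical_set_scope.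
Local Open Scope ring_scope.

(** Write a finitely generated [X] as [R^n / K]; then [X ⊗ M] is [M^n / K M],
    and [K], being a submodule of the noetherian module [R^n], is generated by
    finitely many relations (lemma [noetherian_fg_free]). These give a linear
    map [rel_comb] from [M^r] to [M^n] with image [K M], and likewise for the
    completion [M^] in place of [M].

    Let [t] in [X ⊗ M] lie in every [m^j (X ⊗ M)], and lift it to [u] in [M^n].
    Then [u] lies in [K M + m^j M^n] for every [j] ([adic_tensor] and
    [tens_comb_ker]): the equation [rel_comb y = u] is solvable modulo [m^j] for
    every [j]. Modulo [m^j] the solutions form a coset in [M^r / m^j M^r], a
    module with the descending chain condition because [m] is finitely
    generated, [M / m M] is finitely generated and [R / m] is a field
    ([adic_pow_dcc]). An inverse limit of nonempty cosets in such modules is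
    nonempty ([filtered_lift], a Mittag-Leffler argument), so the equation has a
    solution in [M^]. Hence [t] goes to [0] in [X ⊗ M^], and purity gives
    [t = 0]. *)

(** * Submodules and spans *)

Section Submodules.
Variables (R : comNzRingType) (V : lmodType R).

(** Intermediate submodules are [Prop]-valued sets, so that images, preimages
    and intersections need no Boolean reflection or packaging. *)
Definition is_submod (P : set V) : Prop :=
  P 0 /\ forall a u v, P u -> P v -> P (a *: u + v).

Lemma submod_is_submod (N : submodClosed V) : is_submod [set` N].
Proof. by split=> [|a u v Nu Nv] /=; [exact: rpred0 | rewrite rpredD ?rpredZ]. Qed.

Lemma is_submodD (P : set V) u v : is_submod P -> P u -> P v -> P (u + v).
Proof. by move=> [_ Pl] Pu Pv; rewrite -[u]scale1r; apply: Pl. Qed.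

Lemma is_submodZ (P : set V) a u : is_submod P -> P u -> P (a *: u).
Proof. by move=> [P0 Pl] Pu; rewrite -[_ *: _]addr0; apply: Pl. Qed.

Lemma is_submodB (P : set V) u v : is_submod P -> P u -> P v -> P (u - v).
Proof.
by move=> Ps Pu Pv; apply: is_submodD => //; rewrite -scaleN1r; apply: is_submodZ.
Qed.

Lemma span_ind (S P : set V) : is_submod P -> S `<=` P ->
  forall x, x \in span S -> P x.
Proof.
move=> [P0 Pl] SP x xS.
have Pcl : submod_closed (fun y => `[< P y >]).
  split=> [|a u v]; first exact/asboolP.
  by rewrite !unfold_in => /asboolP Pu /asboolP Pv; apply/asboolP/Pl.
pose N : submodClosed V := HB.pack (fun y => `[< P y >])
  (GRing.isSubmodClosed.Build R V _ Pcl).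
by apply/asboolP; apply: (span_min (N := N)) xS => y /SP Py; apply/asboolP.
Qed.

Lemma span_mono (S S' : set V) : S `<=` S' -> {subset span S <= span S'}.
Proof. by move=> SS'; apply: span_min => x /SS'; apply: span_sub. Qed.

Lemma span_seqP (s : seq V) x : x \in span [set` s] ->
  exists a : 'I_(size s) -> R, x = \sum_i a i *: s`_i.
Proof.
move: x; apply: span_ind => [|x xs]; last first.
  have ltxs : (index x s < size s)%N by rewrite index_mem.
  exists (fun i => (i == Ordinal ltxs)%:R).
  rewrite (bigD1 (Ordinal ltxs)) //= eqxx scale1r nth_index // big1 ?addr0 //.
  by move=> i /negPf ->; rewrite scale0r.
split=> [|c _ _ [a ->] [b ->]].
  by exists (fun=> 0); rewrite big1 // => i _; rewrite scale0r.
exists (fun i => c * a i + b i); rewrite scaler_sumr -big_split /=.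
by apply: eq_bigr => i _; rewrite scalerDl scalerA.
Qed.

Lemma span_setU1 (S : set V) x y : y \in span (x |` S) ->
  exists a, y - a *: x \in span S.
Proof.
move: y; apply: span_ind => [|y [->|Sy]].
- split=> [|c u v [a Ha] [b Hb]]; first by exists 0; rewrite scale0r subr0 rpred0.
  exists (c * a + b); rewrite scalerDl -scalerA opprD addrACA -scalerBr.
  by rewrite rpredD ?rpredZ.
- by exists 1; rewrite scale1r subrr rpred0.
by exists 0; rewrite scale0r subr0 span_sub.
Qed.

End Submodules.

(** * Finite generation over a noetherian ring *)

Section Coordinate.
Variables (R : comNzRingType) (M : lmodType R) (n : nat) (i : 'I_n).

Definition ffun_coord (x : {ffun 'I_n -> M}) : M := x i.

Fact ffun_coord_is_linear : linear ffun_coord.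
Proof. by move=> a u v; rewrite /ffun_coord !ffunE. Qed.

HB.instance Definition _ :=
  GRing.isLinear.Build R {ffun 'I_n -> M} M _ ffun_coord ffun_coord_is_linear.

End Coordinate.

Section Noetherian.
Variable R : comNzRingType.

Definition fg_submod (V : lmodType R) (P : set V) : Prop :=
  exists s : seq V, (forall x, x \in s -> P x) /\ P `<=` [set` span [set` s]].

(** Lifts of generators of the image, together with generators of the part of
    [P] in the kernel, generate [P]. *)
Lemma fg_submod_ext (V W : lmodType R) (f : {linear V -> W}) (P : set V) :
  is_submod P -> fg_submod (f @` P) -> fg_submod [set x | P x /\ f x = 0] ->
  fg_submod P.
Proof.
move=> Ps [s [sP Ps']] [s' [s'P Ps'']].
have /choice[g gP] : forall y, exists x, y \in s -> P x /\ f x = y.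
  move=> y; have [/sP[x Px <-]|] := boolP (y \in s); first by exists x.
  by exists 0.
exists (map g s ++ s'); split=> [x|x Px].
  by rewrite mem_cat => /orP[/mapP[y /gP[? _] ->]|/s'P[]].
have [z zs fz] : exists2 z, P z /\ z \in span [set` map g s ++ s'] & f z = f x.
  have : f x \in span [set` s] by apply: Ps'; exists x.
  move: (f x); apply: span_ind => [|y ys].
    split=> [|a _ _ [u [Pu us] <-] [v [Pv vs] <-]].
      by exists 0; rewrite ?linear0 ?rpred0; split=> //; exact: Ps.1.
    exists (a *: u + v); rewrite ?linearP //; split; first exact: Ps.2.
    by rewrite rpredD ?rpredZ.
  have [Pg fg] := gP y ys; exists (g y) => //; split=> //.
  by apply: span_sub; rewrite /= mem_cat map_f.
rewrite /= -[x](subrK z) rpredD ?zs.2 //.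
apply: (@span_mono _ _ [set` s']) => [w ws|].
  by rewrite /= mem_cat [_ \in s']ws orbT.
by apply: Ps''; rewrite /= linearB fz subrr; split=> //; exact: is_submodB zs.1.
Qed.

Hypothesis noethR : noetherian R.

Lemma noetherian_fg_ideal (P : set R^o) : is_submod P -> fg_submod P.
Proof.
move=> Ps; have [s sP] := noethR (span P); exists s; split=> [x xs|x Px].
  by apply: (@span_ind _ _ P P) => //; rewrite sP span_sub.
by rewrite /= -sP span_sub.
Qed.

(** Induction on the number [k] of coordinates that may be nonzero on [P]: the
    last of them maps [P] onto an ideal, and the part of [P] in its kernel has
    one such coordinate fewer. *)
Lemma noetherian_fg_free n (P : set {ffun 'I_n -> R^o}) :
  is_submod P -> fg_submod P.
Proof.
suff H k : (k <= n)%N -> forall P : set {ffun 'I_n -> R^o}, is_submod P ->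
    (forall x, P x -> forall i : 'I_n, (k <= i)%N -> x i = 0) -> fg_submod P.
  by move=> Ps; apply: (H n) => // x _ i; rewrite leqNgt ltn_ord.
elim: k => [|k IHk] lekn {}P Ps Pk.
  exists [::]; split=> // x Px; suff -> : x = 0 by exact: rpred0.
  by apply/ffunP => i; rewrite (Pk x) ?ffunE.
pose i0 := Ordinal lekn.
apply: (@fg_submod_ext _ _ (ffun_coord i0)) => //.
  apply: noetherian_fg_ideal; split; first by exists 0; [exact: Ps.1|rewrite linear0].
  move=> a _ _ [u Pu <-] [v Pv <-]; exists (a *: u + v); first exact: Ps.2.
  by rewrite linearP.
apply: IHk; first exact: ltnW.
  split; first by split; [exact: Ps.1|rewrite linear0].
  move=> a u v [Pu u0] [Pv v0]; split; first exact: Ps.2.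
  by rewrite linearP u0 v0 scaler0 addr0.
move=> x [Px x0] i; rewrite leq_eqVlt => /orP[/eqP ki|]; last exact: Pk.
by have -> : i = i0 by exact: val_inj.
Qed.

End Noetherian.

(** * A relative descending chain condition *)

Section ChainCondition.
Variables (R : comNzRingType) (m : submodClosed R^o).
Variable V : lmodType R.

(** For submodules [B] of [A], this says that [A / B] satisfies the descending
    chain condition, in the form that the traces [T i `&` A + B] of a chain are
    eventually constant. Stated for chains of submodules of [V] rather than of
    [A / B], it is transitive without any passage to quotients. *)
Definition dcc_mod (A B : set V) : Prop :=
  forall T : nat -> set V, (forall i, is_submod (T i)) ->
    {homo T : i j / (i <= j)%N >-> j `<=` i} ->
  exists c, forall i x, T c x -> A x -> exists2 t, T i t & B (x - t).

Lemma dcc_mod_refl A : dcc_mod A A.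
Proof.
move=> T Ts _; exists 0%N => i x _ Ax; exists 0; rewrite ?subr0 //.
exact: (Ts i).1.
Qed.

(** An element [x] of the chain is replaced, up to an element of [B], by some
    [t] deeper in the chain. The difference [x - t] lies in [B] and in the chain,
    so the condition for [B] and [C] corrects it, up to an element of [C]. *)
Lemma dcc_mod_trans A B C : dcc_mod A B -> dcc_mod B C -> dcc_mod A C.
Proof.
move=> AB BC T Ts Tdecr.
have [c1 H1] := AB T Ts Tdecr; have [c2 H2] := BC T Ts Tdecr.
exists (maxn c1 c2) => i x Tx Ax.
have [t Tt Bxt] := H1 (maxn i c2) x (Tdecr _ _ (leq_maxl _ _) _ Tx) Ax.
have Txt : T c2 (x - t).
  apply: is_submodB => //; first exact: Tdecr _ _ (leq_maxr c1 c2) _ Tx.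
  exact: Tdecr _ _ (leq_maxr i c2) _ Tt.
have [t' Tt' Cxt] := H2 i _ Txt Bxt.
exists (t + t'); last by rewrite opprD addrA.
by apply: is_submodD => //; exact: Tdecr _ _ (leq_maxl i c2) _ Tt.
Qed.

Lemma dcc_mod_sub A A' B : A `<=` A' -> dcc_mod A' B -> dcc_mod A B.
Proof.
move=> sub H T Ts Td; have [c Hc] := H T Ts Td.
by exists c => i x Tx /sub; apply: Hc.
Qed.

Hypothesis max_m : maximal_ideal m.

(** The ideal generated by [m] and [r] contains [1]. *)
Lemma maximal_ideal_inv (r : R) : r \notin m -> exists b, 1 - b * r \in m.
Proof.
move=> rm; case: max_m => m1 mmax.
pose J : submodClosed R^o := span ((r : R^o) |` [set` m]).
have : (1 : R^o) \in J.
  apply: contraNT rm => J1.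
  rewrite -(mmax J _ J1); first by apply: span_sub; left.
  by move=> x xm; apply: span_sub; right.
move=> /span_setU1[b]; exists b.
by apply: (@span_ind _ _ [set` m] [set` m]) => //; exact: submod_is_submod.
Qed.

(** The quotient is generated by [x] and killed by [m], hence zero or simple: a
    chain either falls into [span S] at some stage, or its members always
    contain some [r *: x + b] with [r] outside [m], and then cover all of the
    quotient since [r] is invertible modulo [m]. *)
Lemma dcc_mod_simple (S : set V) x :
  (forall a, a \in m -> a *: x \in span S) ->
  dcc_mod [set` span (x |` S)] [set` span S].
Proof.
move=> mx T Ts _.
have [[c Hc]|Hno] := pselect (exists c, forall y, T c y ->
    y \in span (x |` S) -> y \in span S).
  exists c => i y Ty yA; exists 0; first exact: (Ts i).1.
  by rewrite /= subr0; apply: Hc.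
exists 0%N => i y _ /span_setU1[a ya].
have [z [Tz /span_setU1[r zr] zB]] :
    exists z, [/\ T i z, z \in span (x |` S) & z \notin span S].
  apply: contrapT => no; apply: Hno; exists i => z Tz zA.
  by apply: contrapT => zB; apply: no; exists z; split=> //; apply/negP.
have /maximal_ideal_inv[b brm] : r \notin m.
  apply: contra zB => /mx rx; rewrite -[z](subrK (r *: x)).
  by rewrite rpredD.
exists (a *: (b *: z)); first exact: is_submodZ (Ts i) (is_submodZ _ (Ts i) Tz).
have -> : y - a *: (b *: z) =
    (y - a *: x) + a *: ((1 - b * r) *: x) - a *: (b *: (z - r *: x)).
  have -> : b *: (z - r *: x) = (b *: z - x) + (1 - b * r) *: x.
    by rewrite scalerBr scalerBl scale1r scalerA addrA subrK.
  by rewrite [in RHS]scalerDr opprD addrACA subrr addr0 scalerBr opprB addrA subrK.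
apply: rpredB; last by do 2!apply: rpredZ.
by apply: rpredD => //; apply/rpredZ/mx.
Qed.

(** Adjoining the generators one at a time makes each step simple or trivial. *)
Lemma dcc_mod_fg (A B : set V) (s : seq V) : is_submod B ->
  (forall a x, a \in m -> x \in s -> B (a *: x)) ->
  A `<=` [set` span (B `|` [set` s])] -> dcc_mod A B.
Proof.
move=> Bs ms AB; apply: dcc_mod_sub AB _.
elim: s ms => [|x s IHs] ms.
  apply: dcc_mod_sub (@dcc_mod_refl B); apply: span_ind => // y [] //.
apply: (@dcc_mod_trans _ [set` span (B `|` [set` s])]); last first.
  by apply: IHs => a y am ys; apply: ms => //; rewrite inE ys orbT.
apply: (dcc_mod_sub _ (@dcc_mod_simple (B `|` [set` s]) x _)).
  apply: span_mono => y [By|]; first by right; left.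
  by rewrite /= inE => /orP[/eqP->|ys]; [left|right; right].
by move=> a am; apply: span_sub; left; apply: ms; rewrite ?mem_head.
Qed.

End ChainCondition.

(** * Solving a linear equation along a filtration *)

Section Lifting.
Variables (R : comNzRingType) (V W : lmodType R) (f : {linear V -> W}).
Variables (Vf : nat -> set V) (Wf : nat -> set W).
Hypotheses (Vf_submod : forall j, is_submod (Vf j)).
Hypotheses (Wf_submod : forall j, is_submod (Wf j)).
Hypothesis Wf_anti : {homo Wf : i j / (i <= j)%N >-> j `<=` i}.
Hypothesis f_filt : forall j v, Vf j v -> Wf j (f v).
Hypothesis V_dcc : forall j, dcc_mod setT (Vf j).

(** Let [S j] be the coset of solutions modulo [Wf j]. An approximate solution
    can get stuck, so the sequence is built in the smaller sets [S' j] of those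
    [y] that agree modulo [Vf j] with a solution modulo [Wf i], for every [i].
    The chain condition shows that a solution modulo [Wf c], for [c] large, is
    in [S' j]; thus every element of [S' j] is congruent modulo [Vf j] to one of
    [S' j.+1]. *)
Lemma filtered_lift (u : W) : (forall j, exists v, Wf j (u - f v)) ->
  exists y : nat -> V,
    (forall j, Vf j (y j.+1 - y j)) /\ (forall j, Wf j (u - f (y j))).
Proof.
move=> uW.
pose S j := [set v | Wf j (u - f v)].
pose S' j := [set y | forall i, exists2 s, S i s & Vf j (y - s)].
have stab j : exists c, S c `<=` S' j.
  (* [S i] is a coset of [T i]. *)
  pose T i := [set v | Wf i (f v)].
  have Ts i : is_submod (T i).
    split=> [|a x y Tx Ty]; first by rewrite /T /= linear0; exact: (Wf_submod i).1.
    by rewrite /T /= linearP; apply: (Wf_submod i).2.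
  have Td : {homo T : i j / (i <= j)%N >-> j `<=` i}.
    by move=> i k lik v; apply: Wf_anti.
  have [c Hc] := V_dcc j Ts Td; exists c => s Ss i.
  have [z Sz] := uW (maxn i c).
  have Tsz : T c (s - z).
    rewrite /T /= linearB -[f s](subKr u) addrAC.
    by apply: is_submodB => //; exact: Wf_anti _ _ (leq_maxr i c) _ Sz.
  have [t Tt Vt] := Hc i _ Tsz I.
  exists (z + t); last by rewrite opprD addrA.
  rewrite /S /= linearD opprD addrA; apply: is_submodB => //.
  exact: Wf_anti _ _ (leq_maxl i c) _ Sz.
have /choice[next nextP] : forall p : nat * V, exists y',
    S' p.1 p.2 -> S' p.1.+1 y' /\ Vf p.1 (y' - p.2).
  case=> j y /=; have [S'y|] := pselect (S' j y); last by exists 0.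
  have [c Hc] := stab j.+1; have [s Ss ys] := S'y c.
  exists s => _; split; first exact: Hc.
  by rewrite -opprB -scaleN1r; apply: is_submodZ.
have [y0 S'y0] : exists y0, S' 0%N y0.
  by have [c Hc] := stab 0%N; have [v Sv] := uW c; exists v; apply: Hc.
pose y := fix y j := if j is k.+1 then next (k, y k) else y0.
have S'y j : S' j (y j) by elim: j => //= j /(nextP (j, _))[].
exists y; split=> j; first exact: (nextP (j, _) (S'y j)).2.
have [s Ss Vs] := S'y j j.
rewrite -[y j](subrK s) linearD opprD addrA addrAC.
by apply: is_submodB => //; apply: f_filt.
Qed.

End Lifting.

(** * The adic filtration *)

Section AdicFiltration.
Variables (R : comNzRingType) (m : submodClosed R^o) (M : lmodType R).

Lemma adic0 x : x \in adic m M 0.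
Proof. by apply: span_sub; exists 1 => //; exists x; rewrite ?scale1r. Qed.

Lemma adicZ n a x : a \in m -> x \in adic m M n -> a *: x \in adic m M n.+1.
Proof.
move=> am; move: x; apply: span_ind => [|_ [b bn [y _ <-]]].
  split=> [|c u v]; first by rewrite scaler0; exact: rpred0.
  by move=> um vm; rewrite scalerDr scalerA mulrC -scalerA; apply: rpredD => //;
    apply: rpredZ.
rewrite scalerA; apply: span_sub; exists (a * b) => //; last by exists y.
by apply: span_sub; exists a => //; exists b.
Qed.

Lemma adicS n : {subset adic m M n.+1 <=
  span [set a *: x | a in [set` m] & x in [set` adic m M n]]}.
Proof.
apply: (span_min (N := span _)) => _ [b bn [y _ <-]]; move: b bn.
apply: span_ind => [|_ [a am [b bn <-]]].
  split=> [|c u v um vm] /=; first by rewrite scale0r; exact: rpred0.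
  by rewrite scalerDl -scalerA; apply: rpredD => //; apply: rpredZ.
rewrite -scalerA; apply: span_sub; exists a => //; exists (b *: y) => //.
by apply: span_sub; exists b => //; exists y.
Qed.

Hypothesis noethR : noetherian R.
Hypothesis fgM : fin_gen (quotmod (ideal_smul m M)).

(** The module [m^n M / m^n.+1 M] is generated by the products of [n] generators
    of [m] with lifts of generators of [M / m M]. *)
Lemma adic_fg n : exists s : seq M, [set` s] `<=` [set` adic m M n] /\
  {subset adic m M n <= span ([set` adic m M n.+1] `|` [set` s])}.
Proof.
elim: n => [|n [s [sn ns]]].
  have [q qP] := fgM; exists (map repr q); split=> [x _|x _]; first exact: adic0.
  have [z zs zx] : exists2 z, z \in span [set` map repr q] &
      qpi _ z = qpi (ideal_smul m M) x.
    have := qP (qpi _ x); move: (qpi _ x); apply: span_ind => [|y yq].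
      split=> [|a _ _ [u us <-] [v vs <-]]; first by exists 0; rewrite ?linear0 ?rpred0.
      by exists (a *: u + v); rewrite ?linearP //; apply: rpredD => //; apply: rpredZ.
    by exists (repr y); rewrite ?qpiP //; apply: span_sub; rewrite /= map_f.
  rewrite -[x](subrK z) rpredD //; last by apply: span_mono zs; right.
  have : x - z \in ideal_smul m M by rewrite -qpi_eq zx.
  apply: (span_min (N := span _)) => _ [a am [y _ <-]]; apply: span_sub; left.
  exact: adicZ (adic0 y).
have [h [hm mh]] := noetherian_fg_ideal noethR (submod_is_submod m).
exists [seq a *: x | a <- h, x <- s]; split=> [x|].
  by move=> /allpairsP[[a y] [/= /hm ah ys ->]]; apply: adicZ => //; exact: sn.
move=> x /adicS; apply: (span_min (N := span _)) => _ [a am [y /ns yn <-]].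
move: y yn; apply: span_ind => [|y [yn|ys]].
- split=> [|c u v um vm]; first by rewrite scaler0; exact: rpred0.
  by rewrite scalerDr scalerA mulrC -scalerA; apply: rpredD => //; apply: rpredZ.
- by apply: span_sub; left; apply: adicZ.
move: (a) (mh a am); apply: span_ind => [|b bh].
  split=> [|c u v um vm]; first by rewrite scale0r; exact: rpred0.
  by rewrite scalerDl -scalerA; apply: rpredD => //; apply: rpredZ.
by apply: span_sub; right; apply/allpairsP; exists (b, y).
Qed.

Definition adic_pow r n : set {ffun 'I_r -> M} :=
  [set y | forall i, y i \in adic m M n].

Lemma adic_pow_submod r n : is_submod (@adic_pow r n).
Proof.
split=> [|a u v un vn] i; first by rewrite ffunE rpred0.
by rewrite !ffunE; apply: rpredD => //; apply: rpredZ.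
Qed.

Lemma adic_pow_anti r : {homo @adic_pow r : i j / (i <= j)%N >-> j `<=` i}.
Proof. by move=> i j lij y yj k; apply: adic_anti lij _ _. Qed.

Hypothesis max_m : maximal_ideal m.

(** Each quotient of consecutive terms of the filtration of [M^r] is finitely
    generated and killed by [m], that is, a finite-dimensional vector space over
    [R / m]; the elements [d i x] put a generator [x] in coordinate [i]. *)
Lemma adic_pow_dcc r n : dcc_mod setT (@adic_pow r n).
Proof.
elim: n => [|n IHn].
  by apply: (dcc_mod_sub _ (@dcc_mod_refl _ _ _)) => y _ i; apply: adic0.
apply: dcc_mod_trans IHn _; have [s [sn ns]] := adic_fg n.
pose d (i : 'I_r) (x : M) : {ffun 'I_r -> M} := [ffun j => if j == i then x else 0].
apply: (@dcc_mod_fg _ m _ max_m _ _ [seq d i x | i <- enum 'I_r, x <- s]).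
- exact: adic_pow_submod.
- move=> a _ am /allpairsP[[i x] [/= _ /sn xn ->]] j; rewrite !ffunE.
  by case: ifP => _; rewrite ?scaler0 ?rpred0 //; apply: adicZ.
move=> y yn.
have -> : y = \sum_i d i (y i).
  apply/ffunP => j; rewrite sum_ffunE (bigD1 j) //= big1 ?ffunE ?eqxx ?addr0 //.
  by move=> i; rewrite ffunE eq_sym => /negPf ->.
apply: rpred_sum => i _; have := ns _ (yn i); move: (y i).
apply: span_ind => [|x [xn|xs]].
- split=> [|c u v um vm].
    by have -> : d i 0 = 0; [apply/ffunP => j; rewrite !ffunE if_same | exact: rpred0].
  have -> : d i (c *: u + v) = c *: d i u + d i v.
    by apply/ffunP => j; rewrite !ffunE; case: ifP; rewrite ?scaler0 ?addr0.
  by apply: rpredD => //; apply: rpredZ.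
- by apply: span_sub; left => j; rewrite ffunE; case: ifP; rewrite ?rpred0.
by apply: span_sub; right; apply/allpairsP; exists (i, x); rewrite mem_enum.
Qed.

End AdicFiltration.

Section Completion.
Variables (R : comNzRingType) (m : submodClosed R^o) (M : lmodType R).

(** A sequence with [y n.+1 - y n] in [m^n M] is Cauchy and defines a point of
    the completion, whose [n]-th component is already the class of [y n]. *)
Lemma completion_of_seq (y : nat -> M) :
  (forall n, y n.+1 - y n \in adic m M n) ->
  exists z : completion m M, forall n, completion_val z n = qpi _ (y n).
Proof.
move=> yC.
have zP : ((fun n => qpi (adic m M n) (y n)) : prodmod _) \in @coherent R m M.
  apply/asboolP => i j lij; rewrite adic_projE //; apply/eqP; rewrite qpi_eq.
  elim: j lij => [|j IHj]; first by rewrite leqn0 => /eqP->; rewrite subrr rpred0.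
  rewrite leq_eqVlt => /orP[/eqP->|lij]; first by rewrite subrr rpred0.
  rewrite -[y j.+1](subrK (y j)) -addrA rpredD ?IHj //.
  by apply: adic_anti (yC j).
by exists (Completion zP).
Qed.

Definition completion_coord n (z : completion m M) : quotmod (adic m M n) :=
  completion_val z n.

Fact completion_coord_is_linear n : linear (completion_coord n).
Proof. by []. Qed.

HB.instance Definition _ n := GRing.isLinear.Build R (completion m M)
  (quotmod (adic m M n)) _ (completion_coord n) (completion_coord_is_linear n).

End Completion.

(** * Tensor products with a finitely generated module *)

Section Relations.
Variables (R : comNzRingType) (X : lmodType R) (n : nat) (e : 'I_n -> X).

Definition relations : set {ffun 'I_n -> R^o} :=
  [set k | \sum_i (k i : R) *: e i = 0].

Lemma relations_submod : is_submod relations.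
Proof.
split=> [|a u v]; rewrite /relations /=.
  by rewrite big1 // => i _; rewrite ffunE scale0r.
move=> u0 v0; under eq_bigr do rewrite !ffunE scalerDl -scalerA.
by rewrite big_split /= -scaler_sumr u0 v0 scaler0 addr0.
Qed.

Variable A : lmodType R.

Lemma tensor_ind (P : set (tensor X A)) : is_submod P ->
  (forall x y, P (tens x y)) -> forall t, P t.
Proof.
move=> Ps Pt t; rewrite -[t]qpiP; elim/freeg_ind_dom0: (repr t).
  by rewrite linear0; exact: Ps.1.
move=> k [x y] D _ _ IHD.
have -> : << k *g (x, y) >> = k *: << 1 *g (x, y) >> :> {freeg (X * A) / R}.
  by apply/eqP/freeg_eqP => q; rewrite coeffZ !coeffU mul1r.
by rewrite linearP; apply: Ps.2 => //; apply: Pt.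
Qed.

Definition tens_comb (v : {ffun 'I_n -> A}) : tensor X A :=
  \sum_i tens (e i) (v i).

Fact tens_comb_is_linear : linear tens_comb.
Proof.
move=> a u v; rewrite /tens_comb scaler_sumr -big_split /=.
by apply: eq_bigr => i _; rewrite !ffunE tens_linearr.
Qed.

HB.instance Definition _ := GRing.isLinear.Build R {ffun 'I_n -> A} _ _
  tens_comb tens_comb_is_linear.

Definition vec_scale (k : {ffun 'I_n -> R^o}) (y : A) : {ffun 'I_n -> A} :=
  [ffun i => (k i : R) *: y].

Lemma vec_scale_linearl y : linear (vec_scale^~ y).
Proof. by move=> a k l; apply/ffunP => i; rewrite !ffunE scalerDl scalerA. Qed.

Lemma vec_scale_linearr k : linear (vec_scale k).
Proof.
move=> a y z; apply/ffunP => i; rewrite !ffunE scalerDr; congr (_ + _).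
by rewrite !scalerA mulrC.
Qed.

Lemma tens_comb_vec_scale k y :
  tens_comb (vec_scale k y) = tens (\sum_i (k i : R) *: e i) y.
Proof.
pose f : {linear X -> tensor X A} := HB.pack (fun x : X => tens x y)
  (GRing.isLinear.Build R X (tensor X A) _ _ (tens_linearl y)).
pose g i : {linear A -> tensor X A} := HB.pack (fun y : A => tens (e i) y)
  (GRing.isLinear.Build R A (tensor X A) _ _ (@tens_linearr _ X A (e i))).
rewrite -[RHS]/(f _) linear_sum; apply: eq_bigr => i _.
by rewrite ffunE -[LHS]/(g i _) !linearZ.
Qed.

Hypothesis genX : forall x,
  exists a : {ffun 'I_n -> R^o}, x = \sum_i (a i : R) *: e i.

Lemma tens_comb_surj t : exists v, t = tens_comb v.
Proof.
move: t; apply: tensor_ind => [|x y]; last first.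
  by have [a ->] := genX x; exists (vec_scale a y); rewrite tens_comb_vec_scale.
split=> [|a _ _ [u ->] [v ->]]; first by exists 0; rewrite linear0.
by exists (a *: u + v); rewrite linearP.
Qed.

(** As the [e i] generate [X], scalars from [m^j] can be moved to the
    coefficients in [A]. *)
Lemma adic_tensor (m : submodClosed R^o) j t : t \in adic m (tensor X A) j ->
  exists2 w, adic_pow m j w & t = tens_comb w.
Proof.
move: t; apply: span_ind => [|_ [a aj [t _ <-]]].
  split=> [|a _ _ [u uj ->] [v vj ->]].
    by exists 0; [exact: (@adic_pow_submod R m A n j).1 | rewrite linear0].
  by exists (a *: u + v); [exact: (@adic_pow_submod R m A n j).2 | rewrite linearP].
have [v ->] := tens_comb_surj t; exists (a *: v); last by rewrite linearZ.
by move=> i; rewrite ffunE; apply: span_sub; exists a => //; exists (v i).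
Qed.

(** Since [e] generates [X], choosing coordinates [c x] of [x] on [e] gives a
    map from [X * A] to [A^n / K A], with [K] the relations of [e]. It is
    bilinear, as two choices of coordinates differ by a relation, and the map it
    induces on [X ⊗ A] sends [tens_comb v] back to the class of [v]. *)
Lemma tens_comb_eq0 v : tens_comb v = 0 ->
  v \in span [set vec_scale k y | k in relations & y in setT].
Proof.
move=> v0; set S := (S in span S); pose N : submodClosed _ := span S.
have [c cP] := choice genX.
pose b x y : quotmod N := qpi N (vec_scale (c x) y).
have b_rel (k l : {ffun 'I_n -> R^o}) y :
    \sum_i (k i : R) *: e i = \sum_i (l i : R) *: e i ->
    qpi N (vec_scale k y) = qpi N (vec_scale l y).
  move=> kl; apply/eqP; rewrite qpi_eq.
  have -> : vec_scale k y - vec_scale l y = vec_scale (k - l) y.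
    by apply/ffunP => i; rewrite !ffunE scalerBl.
  apply: span_sub; exists (k - l); last by exists y.
  rewrite /relations /=; under eq_bigr do rewrite !ffunE scalerBl.
  by rewrite sumrB kl subrr.
have bB : bilinear_for *:%R *:%R b.
  split=> [y|x] a u w; last by rewrite /b vec_scale_linearr linearP.
  rewrite /b -linearP -[in RHS]vec_scale_linearl; apply: b_rel.
  rewrite -cP; under eq_bigr do rewrite !ffunE scalerDl -scalerA.
  by rewrite big_split /= -scaler_sumr -!cP.
pose f : {linear tensor X A -> quotmod N} := HB.pack (tensor_lift b)
  (GRing.isLinear.Build R _ _ _ _ (tensor_lift_linear bB)).
suff fv : f (tens_comb v) = qpi N v.
  by rewrite -[v]subr0 -qpi_eq -fv v0 !linear0.
rewrite linear_sum /=.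
under eq_bigr => i _ do rewrite tensor_liftE //.
have vE : v = \sum_i vec_scale [ffun l => (l == i)%:R] (v i).
  apply/ffunP => l; rewrite sum_ffunE (bigD1 l) //= big1.
    by rewrite !ffunE eqxx scale1r addr0.
  by move=> i; rewrite !ffunE eq_sym => /negPf ->; rewrite scale0r.
rewrite [in RHS]vE linear_sum; apply: eq_bigr => i _; apply: b_rel.
rewrite -cP (bigD1 i) //= big1 ?ffunE ?eqxx ?scale1r ?addr0 //.
by move=> l /negPf li; rewrite ffunE li scale0r.
Qed.

Variable s : seq {ffun 'I_n -> R^o}.

(** The map from [A^r] to [A^n] given by the matrix with columns [s]. *)
Definition rel_comb (y : {ffun 'I_(size s) -> A}) : {ffun 'I_n -> A} :=
  \sum_(j < size s) vec_scale s`_j (y j).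

Fact rel_comb_is_linear : linear rel_comb.
Proof.
move=> a u v; rewrite /rel_comb scaler_sumr -big_split /=.
by apply: eq_bigr => i _; rewrite !ffunE vec_scale_linearr.
Qed.

HB.instance Definition _ := GRing.isLinear.Build R {ffun 'I_(size s) -> A} _ _
  rel_comb rel_comb_is_linear.

Lemma rel_combE y i : rel_comb y i = \sum_(j < size s) (s`_j i : R) *: y j.
Proof. by rewrite sum_ffunE; apply: eq_bigr => j _; rewrite ffunE. Qed.

Hypothesis s_rel : forall k, k \in s -> relations k.

Lemma tens_comb_rel_comb y : tens_comb (rel_comb y) = 0.
Proof.
rewrite linear_sum big1 // => j _; rewrite /= tens_comb_vec_scale.
have -> : \sum_i (s`_j i : R) *: e i = 0 by apply: s_rel; apply: mem_nth.
pose f : {linear X -> tensor X A} := HB.pack (fun x : X => tens x (y j))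
  (GRing.isLinear.Build R X (tensor X A) _ _ (tens_linearl (y j))).
by rewrite -[LHS]/(f _) linear0.
Qed.

Hypothesis rel_s : relations `<=` [set` span [set` s]].

Lemma tens_comb_ker v : tens_comb v = 0 -> exists y, v = rel_comb y.
Proof.
move=> /tens_comb_eq0; move: v; apply: span_ind => [|_ [k /rel_s ks [y _ <-]]].
  split=> [|a _ _ [u ->] [v ->]]; first by exists 0; rewrite linear0.
  by exists (a *: u + v); rewrite linearP.
have [a ->] := span_seqP ks; exists [ffun j => a j *: y]; apply/ffunP => i.
rewrite rel_combE ffunE sum_ffunE scaler_suml; apply: eq_bigr => j _.
by rewrite !ffunE scalerA mulrC.
Qed.

End Relations.

Theorem mainTheorem11 (R : comNzRingType) (m : submodClosed R^o)
    (M : lmodType R)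
    (noethR : noetherian R)
    (localR : local_ring m)
    (sepM : separated m M)
    (fgM : fin_gen (quotmod (ideal_smul m M)))
    (pureM : pure (to_completion m M)) :
  totally_separated m M.
Proof.
move=> X [s0 fgX] t t_adic.
pose e (i : 'I_(size s0)) : X := s0`_i.
have genX x : exists a : {ffun 'I_(size s0) -> R^o}, x = \sum_i (a i : R) *: e i.
  have [a ->] := span_seqP (fgX x); exists (finfun a).
  by apply: eq_bigr => i _; rewrite ffunE.
have [s [s_rel rel_s]] := noetherian_fg_free noethR (relations_submod e).
have [u tu] := tens_comb_surj genX t.
(* Lift [u] along the map [M^r -> M^n] given by the relations [s]. *)
have [j v vj i|j|y [yC uy]] := @filtered_lift _ _ _ (@rel_comb R _ M s)
  (@adic_pow R m M _) (@adic_pow R m M _) (@adic_pow_submod _ _ _ _)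
  (@adic_pow_submod _ _ _ _) (@adic_pow_anti _ _ _ _) _
  (adic_pow_dcc noethR fgM localR.1 (r := _)) u.
- rewrite rel_combE; apply: rpred_sum => k _.
  by apply: rpredZ; apply: vj.
- have tj : t \in adic m (tensor X M) j.
    by apply: (adic_anti (leqnSn j)); apply: t_adic.
  have [w wj tw] := adic_tensor genX tj.
  have [|v uwv] := tens_comb_ker genX rel_s (v := u - w).
    by rewrite linearB /= -tu -tw subrr.
  by exists v; rewrite /= -uwv subKr.
have /choice[z zP] : forall k, exists z : completion m M,
    forall n, completion_val z n = qpi _ (y n k).
  move=> k; apply: completion_of_seq => n.
  by have := yC n k; rewrite !ffunE.
(* In the completion, [u] becomes the combination of relations with
   coefficients [z], so the image of [t] vanishes. *)
apply: (pureM X); rewrite linear0 tu linear_sum /=.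
under eq_bigr do rewrite tensor_mapE.
transitivity (tens_comb e (rel_comb (A := completion m M) (s := s) (finfun z))).
  apply: eq_bigr => i _; congr tens; rewrite rel_combE.
  apply: val_inj; apply: functional_extensionality_dep => n.
  transitivity (qpi (adic m M n) (rel_comb (s := s) (y n) i)).
    by apply/eqP; rewrite qpi_eq; have := uy n i; rewrite !ffunE.
  rewrite -[RHS]/(completion_coord n _) rel_combE !linear_sum.
  apply: eq_bigr => k _; rewrite !linearZ /= ffunE; congr (_ *: _).
  by rewrite -zP.
exact: tens_comb_rel_comb.
Qed.
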